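(* For every positive integer $t$ there exist constants $\alpha,\beta,\gamma>0$ such that for all positive integers $s$ and $n\geq 2$, $$R_t(s,n)\leq \alpha s^{\beta} n\cdot (\log n)^{\gamma}.$$
   Context: A function $f:\mathbb{R}^{m}\to\mathbb{R}$ is linear if $f(\mathbf{x})=b+\sum_{i=1}^m a_i\mathbf{x}(i)$ for some reals $a_1,\dots,a_m,b$. A (finite, simple) graph $G$ is semilinear of complexity $t$ if $V(G)\subset\mathbb{R}^d$ for some positive integer $d$, and there are $t$ linear functions $f_1,\dots,f_t:\mathbb{R}^d\times\mathbb{R}^d\to\mathbb{R}$ and a Boolean function $\phi:\{\mathrm{F},\mathrm{T}\}^{3t}\to\{\mathrm{F},\mathrm{T}\}$ such that for distinct $\mathbf{x},\mathbf{y}\in V(G)$, $\{\mathbf{x},\mathbf{y}\}$ is an edge iff $\phi\big(\{f_i(\mathbf{x},\mathbf{y})<0,\ f_i(\mathbf{x},\mathbf{y})\leq 0,\ f_i(\mathbf{x},\mathbf{y})=0\}_{i\in[t]}\big)=\mathrm{T}$; it is assumed that this truth value is unchanged when $\mathbf{x}$ and $\mathbf{y}$ are swapped. $R_t(s,n)$ denotes the smallest $N$ such that every semilinear graph of complexity $t$ on $N$ vertices contains a clique of size $s$ or an independent set of size $n$. *)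

(* Defs.v *)
From HB Require Import structures.
From mathcomp Require Import all_boot all_order all_algebra.
From mathcomp Require Import all_classical all_reals all_analysis.
Set Implicit Arguments. Unset Strict Implicit. Unset Printing Implicit Defensive.
Import Order.TTheory GRing.Theory Num.Theory.
Local Open Scope ring_scope.

Definition linval (R : realType) (d : nat) (a b : 'I_d -> R) (c : R)
  (x y : 'I_d -> R) : R :=
  c + \sum_(k < d) a k * x k + \sum_(k < d) b k * y k.

(* Edge predicate of a semilinear graph of complexity t: the t linear
   functions are (A i, B i, C i), i < t, and phi is the Boolean function of
   the 3t truth values (f_i < 0, f_i <= 0, f_i = 0), i < t. *)
Definition sl_edge (R : realType) (t d : nat) (A B : 'I_t -> 'I_d -> R)
  (C : 'I_t -> R) (phi : ('I_t -> bool * bool * bool) -> bool)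
  (x y : 'I_d -> R) : bool :=
  phi (fun i => let v := linval (A i) (B i) (C i) x y in
                (v < 0, v <= 0, v == 0)).

Definition ramsey_prop (R : realType) (t s n N : nat) : Prop :=
  forall (d : nat) (p : 'I_N -> ('I_d -> R)) (A B : 'I_t -> 'I_d -> R)
         (C : 'I_t -> R) (phi : ('I_t -> bool * bool * bool) -> bool),
    (0 < d)%N ->
    injective p ->
    (forall i j : 'I_N, i != j ->
       sl_edge A B C phi (p i) (p j) = sl_edge A B C phi (p j) (p i)) ->
    (exists S : {set 'I_N}, #|S| = s /\
        {in S &, forall i j, i != j -> sl_edge A B C phi (p i) (p j)})
    \/
    (exists S : {set 'I_N}, #|S| = n /\
        {in S &, forall i j, i != j -> ~~ sl_edge A B C phi (p i) (p j)}).

(* Main.v *)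
(* Every linear function splits as f_i(x, y) = a_i(x) - b_i(y), so the edges
   depend only on the comparisons of a_i(x) with b_i(y), and ranking turns these
   reals into naturals below 2^K, with K logarithmic in the number N of vertices.
   View the naturals as leaves of a binary tree, and let v_i(x) be the node at
   which a_i(x) and b_i(x) branch off.  Among vertices with the same heights of
   v_i and the same orders of a_i, b_i -- this costs (4(K+1))^t colours -- the
   comparison of a_i(x) with b_i(y) is determined by that of v_i(x) with v_i(y).
   Hence the pairs x < y with a prescribed comparison vector of v(x) and v(y) form
   a strict order, and are all edges or all non-edges.  A graph without s-clique
   has no s-chain in the orders consisting of edges, so by Mirsky s colours
   suffice for each of them, and (4(K+1))^t s^(4^t) colours for the graph. *)
Require Import Defs.
From HB Require Import structures.
From mathcomp Require Import all_boot all_order all_algebra.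
From mathcomp Require Import all_classical all_reals all_analysis.
From mathcomp Require Import zify ring.
Import Order.TTheory GRing.Theory Num.Theory.
Local Open Scope ring_scope.

(** * Pigeonhole and colouring a strict order by heights *)

Lemma subset_of_card (T : finType) (A : {set T}) (k : nat) :
  (k <= #|A|)%N -> exists2 B : {set T}, B \subset A & #|B| = k.
Proof.
case/card_geqP=> s [us ss sA]; exists [set x in s].
  by apply/fintype.subsetP => x; rewrite inE => /sA.
by rewrite cardsE (card_uniqP us).
Qed.

Lemma pigeonhole (V T : finType) (c : V -> T) (n : nat) :
  (#|T| * n < #|V|)%N -> exists k, (n < #|[set x | c x == k]|)%N.
Proof.
move=> hT; apply/existsP; apply: contraLR hT.
rewrite negb_exists -leqNgt => /forallP small.
rewrite -sum1_card (partition_big c xpredT) //= -sum_nat_const.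
apply: leq_sum => k _; rewrite sum1_card.
by have := small k; rewrite -leqNgt cardsE.
Qed.

(** For a strict order this is a chain, for a symmetric relation a clique; one notion serves
    both. *)
Definition chain {V : finType} (r : rel V) (S : {set V}) : bool :=
  [forall i in S, forall j in S, (i != j) ==> r i j || r j i].

Lemma chainP (V : finType) (r : rel V) (S : {set V}) :
  reflect {in S &, forall i j, i != j -> r i j || r j i} (chain r S).
Proof.
apply: (iffP forall_inP) => [h i j iS jS ij|h i iS].
  by have /forall_inP/(_ j jS)/implyP/(_ ij) := h i iS.
by apply/forall_inP => j jS; apply/implyP; apply: h.
Qed.

(* Mirsky: colour a vertex by the size of a longest chain below it. *)
Lemma height_coloring (V : finType) (r : rel V) (s : nat) :
  transitive r -> irreflexive r ->
  (forall S : {set V}, chain r S -> #|S| <> s) ->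
  exists h : V -> 'I_s, forall i j, r i j -> h i != h j.
Proof.
move=> rtr rirr noS.
pose below x : pred {set V} := fun S => chain r S && [forall y in S, r y x].
have below0 x : below x finset.set0.
  apply/andP; split; first by apply/chainP => i j; rewrite inE.
  by apply/forall_inP => i; rewrite inE.
pose h x := \max_(S | below x S) #|S|.
have hP x : exists2 S, below x S & h x = #|S|.
  have h0 : (0 < #|below x|)%N by apply/card_gt0P; exists finset.set0; exact: below0.
  by have [S bS hS] := eq_bigmax_cond (fun S : {set V} => #|S|) h0; exists S.
have hs x : (h x < s)%N.
  have [S /andP[/chainP cS _] ->] := hP x; rewrite ltnNge; apply/negP.
  (* Only chains of size exactly [s] are excluded, so a longer one is cut down to size [s]. *)
  case/subset_of_card=> B /fintype.subsetP BS cB; apply: (noS B) cB.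
  by apply/chainP => i j /BS iS /BS jS; apply: cS.
exists (fun x => Ordinal (hs x)) => i j rij.
suff: (h i < h j)%N by apply: contraTneq => -[->]; rewrite ltnn.
have [S /andP[/chainP cS /forall_inP bS] ->] := hP i.
have iS : i \notin S by apply/negP => /bS; rewrite rirr.
suff bU : below j (i |: S).
  have := leq_bigmax_cond (F := fun S : {set V} => #|S|) (i |: S) bU.
  by rewrite cardsU1 iS add1n.
apply/andP; split; last first.
  by apply/forall_inP => y /setU1P[->//|/bS /rtr]; apply.
apply/chainP => y z /setU1P[->|yS] /setU1P[->|zS]; rewrite ?eqxx //.
- by rewrite (bS z zS) orbT.
- by rewrite (bS y yS).
- exact: cS.
Qed.

(** * Comparing leaves of a binary tree through branching nodes *)

Definition cmp (a b : nat) : bool * bool := ((a < b)%N, a == b).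

Lemma cmp_trans (a b c : nat) (o : bool * bool) :
  cmp a b = o -> cmp b c = o -> cmp a c = o.
Proof. by rewrite /cmp => <- [h1 h2]; congr pair; lia. Qed.

Lemma level_exists (a b : nat) : exists l, (a %/ 2 ^ l == b %/ 2 ^ l)%N.
Proof.
exists (a + b)%N; rewrite !divn_small //.
  by apply: leq_ltn_trans (ltn_expl _ (ltnSn 1)); rewrite leq_addl.
by apply: leq_ltn_trans (ltn_expl _ (ltnSn 1)); rewrite leq_addr.
Qed.

(* The height of the least common ancestor of the leaves [a] and [b] of the
   infinite binary tree, whose nodes at height [l] are the [a %/ 2 ^ l]. *)
Definition level (a b : nat) : nat := ex_minn (level_exists a b).

Lemma level_le (K a b : nat) :
  (a < 2 ^ K)%N -> (b < 2 ^ K)%N -> (level a b <= K)%N.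
Proof.
rewrite /level; case: ex_minnP => l _ lmin aK bK; apply: lmin.
by rewrite !divn_small.
Qed.

(* If the nodes [v] and [v'] agree, then their midpoint separates [a] from [b]
   and [a'] from [b'] in the same direction, unless [a = b = a' = b']. *)
Lemma cmp_by_level (a b a' b' : nat) :
  level a b = level a' b' -> cmp a b = cmp a' b' ->
  let v := (a %/ 2 ^ level a b)%N in let v' := (a' %/ 2 ^ level a' b')%N in
  cmp a b' = if v == v' then cmp a b else cmp v v'.
Proof.
rewrite /level; case: ex_minnP => l /eqP ab lmin; case: ex_minnP => l' /eqP ab'.
move=> lmin' ll' cab /=; subst l'.
have divlt x y m : (x %/ 2 ^ m < y %/ 2 ^ m -> x < y)%N.
  by rewrite !ltnNge; apply: contra => /leq_div2r; apply.
case: ifPn => [/eqP vv|nvv]; last first.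
  (* The leaf [b'] lies under [v'], and distinct nodes of equal height order all their leaves. *)
  have : (a %/ 2 ^ l < b' %/ 2 ^ l)%N \/ (b' %/ 2 ^ l < a %/ 2 ^ l)%N.
    by move: nvv; rewrite ab'; lia.
  by rewrite ab' /cmp => -[] h; move: (divlt _ _ _ h) => h'; congr pair; lia.
case: l => [|l] in ab ab' lmin lmin' vv *.
  by move: ab ab' vv; rewrite expn0 !divn1 => -> -> ->.
(* By minimality of the height, [a] and [b] lie under different children of the common node, and so
   do [a'] and [b']; equal comparisons put [a] and [a'] on the same side. *)
have nd : (a %/ 2 ^ l <> b %/ 2 ^ l)%N by move=> /eqP /lmin; lia.
have nd' : (a' %/ 2 ^ l <> b' %/ 2 ^ l)%N by move=> /eqP /lmin'; lia.
move: ab ab' vv cab; rewrite expnSr !divnMA /cmp => ab ab' vv [ltab eqab].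
move: (@divlt a b l) (@divlt b a l) (@divlt a' b' l) (@divlt b' a' l).
move: (@divlt a b' l) (@divlt b' a l) nd nd' ab ab' vv.
move: (a %/ 2 ^ l)%N (b %/ 2 ^ l)%N (a' %/ 2 ^ l)%N (b' %/ 2 ^ l)%N.
by move=> {divlt lmin lmin'} *; congr pair; lia.
Qed.

(** * Colouring a graph defined by comparisons *)

Lemma comparison_graph_coloring (N t K s : nat) (e : rel 'I_N)
    (a b : 'I_N -> 'I_t -> nat) :
  (forall x i, a x i < 2 ^ K)%N -> (forall x i, b x i < 2 ^ K)%N ->
  (forall x y z w, (forall i, cmp (a x i) (b y i) = cmp (a z i) (b w i)) ->
     e x y = e z w) ->
  (forall S : {set 'I_N}, chain e S -> #|S| <> s) ->
  exists2 T : finType, #|T| = ((4 * K.+1) ^ t * s ^ (4 ^ t))%N &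
    exists c : 'I_N -> T, forall x y : 'I_N, (x < y)%N -> c x = c y -> ~~ e x y.
Proof.
move=> aK bK edet noS.
pose lev x i := level (a x i) (b x i).
pose v x i := (a x i %/ 2 ^ lev x i)%N.
have levK x i : (lev x i < K.+1)%N by rewrite ltnS level_le.
pose code x : {ffun 'I_t -> 'I_K.+1 * (bool * bool)} :=
  [ffun i => (Ordinal (levK x i), cmp (a x i) (b x i))].
pose sgn x y : {ffun 'I_t -> bool * bool} := [ffun i => cmp (v x i) (v y i)].
have codeE x y : code x = code y -> forall i,
    lev x i = lev y i /\ cmp (a x i) (b x i) = cmp (a y i) (b y i).
  move=> /ffunP cxy i; have := cxy i; rewrite !ffunE => cE.
  by split; [move/(congr1 fst)/(congr1 val): cE|move/(congr1 snd): cE].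
have cmpE x y : code x = code y -> forall i, cmp (a x i) (b y i) =
    if (sgn x y i).2 then cmp (a x i) (b x i) else sgn x y i.
  move=> /codeE cxy i; have [l1 l2] := cxy i.
  by rewrite (cmp_by_level _ _ _ _ l1 l2) ffunE.
have edge_det x y z w : code x = code y -> code z = code w -> code x = code z ->
    sgn x y = sgn z w -> e x y = e z w.
  move=> cxy czw cxz sE; apply: edet => i.
  by rewrite (cmpE _ _ cxy) (cmpE _ _ czw) sE (codeE _ _ cxz i).2.
pose r (o : {ffun 'I_t -> bool * bool}) : rel 'I_N := fun x y =>
  [&& (x < y)%N, code x == code y, sgn x y == o & e x y].
have rtr o : transitive (r o).
  move=> y x z /and4P[xy /eqP cxy /eqP sxy exy] /and4P[yz /eqP cyz /eqP syz eyz].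
  have sxz : sgn x z = o.
    apply/ffunP => i; move: sxy syz => /ffunP/(_ i) + /ffunP/(_ i).
    by rewrite !ffunE; apply: cmp_trans.
  rewrite /r (ltn_trans xy yz) cxy cyz sxz !eqxx /=.
  (* The pairs [(x, y)] and [(x, z)] share codes and sign vector, so one is an edge iff the other
     is. *)
  by rewrite -(edge_det x y x z) // ?cxy ?cyz // sxz.
have rirr o : irreflexive (r o) by move=> x; rewrite /r ltnn.
have rnoS o S : chain (r o) S -> #|S| <> s.
  move/chainP => cS; apply: noS; apply/chainP => i j iS jS ij.
  by case/orP: (cS i j iS jS ij) => /and4P[_ _ _ ->]; rewrite ?orbT.
have /boolp.choice[h hP] := fun o =>
  height_coloring _ _ _ (rtr o) (rirr o) (rnoS o).
exists ({ffun 'I_t -> 'I_K.+1 * (bool * bool)} *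
        {ffun {ffun 'I_t -> bool * bool} -> 'I_s})%type.
  rewrite card_prod !card_ffun !card_prod !card_ord card_bool.
  by rewrite [(K.+1 * _)%N]mulnC.
(* Equal colours give equal heights in the order indexed by the sign vector of the pair itself,
   which excludes an edge. *)
exists (fun x => (code x, [ffun o => h o x])) => x y xy [cxy] /ffunP/(_ (sgn x y)).
rewrite !ffunE => hxy; apply/negP => exy.
by have := hP (sgn x y) x y; rewrite /r xy cxy exy !eqxx hxy eqxx => /(_ isT).
Qed.

(** * From real comparisons to ranks *)

(** If [f u < f w], then [u] is counted for [w] but not for itself, so the inclusion of lower sets
    is proper. *)
Lemma card_lt_homo (d : Order.disp_t) (X : orderType d) (W : finType)
    (f : W -> X) (u w : W) :
  (#|[set z | (f z < f u)%O]| < #|[set z | (f z < f w)%O]|)%N = (f u < f w)%O.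
Proof.
have mono x y : (f x <= f y)%O ->
    [set z | (f z < f x)%O] \subset [set z | (f z < f y)%O].
  by move=> xy; apply/fintype.subsetP => z; rewrite !inE => /lt_le_trans; apply.
case: ltP => [uw|wu]; last by rewrite ltnNge subset_leq_card // mono.
apply: proper_card; rewrite properE mono ?ltW //=.
by apply/fintype.subsetPn; exists u; rewrite !inE ?uw // ltxx.
Qed.

Lemma card_lt_eq (d : Order.disp_t) (X : orderType d) (W : finType)
    (f : W -> X) (u w : W) :
  (#|[set z | (f z < f u)%O]| == #|[set z | (f z < f w)%O]|) = (f u == f w).
Proof.
by rewrite eqn_leq eq_le; congr andb; rewrite leqNgt card_lt_homo leNgt.
Qed.

Lemma ramsey_prop_of_coloring (R : realType) (t s n N K : nat) :
  (2 * N <= 2 ^ K)%N -> (0 < s)%N -> (0 < n)%N ->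
  ((4 * K.+1) ^ t * s ^ (4 ^ t) * n <= N)%N -> ramsey_prop R t s n N.
Proof.
move=> NK s0 n0 Nbig d p A B C phi _ _ esym.
set e : rel 'I_N := fun x y => sl_edge A B C phi (p x) (p y).
have [[S SP]|noS] := boolp.pselect (exists S : {set 'I_N}, #|S| = s /\ chain e S).
  left; exists S; split; [exact: SP.1|move=> i j iS jS ij].
  have /chainP/(_ i j iS jS ij)/orP[//|] := SP.2.
  by rewrite -esym // eq_sym.
right.
(* Both halves of a linear function, signed so that their difference is [linval], are ranked jointly
   among [2 * N] elements; none counts itself, so ranks stay below [2 * N]. *)
pose f i (u : 'I_N + 'I_N) : R := match u with
  | inl x => C i + \sum_(k < d) A i k * p x k
  | inr x => - \sum_(k < d) B i k * p x k end.
pose rk i u := #|[set z | (f i z < f i u)%O]|.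
have rkK i u : (rk i u < 2 ^ K)%N.
  have cW : #|{: 'I_N + 'I_N}| = (2 * N)%N.
    by rewrite card_sum card_ord mul2n addnn.
  apply: leq_trans NK; rewrite -cW -cardsT; apply: proper_card; rewrite properE finset.subsetT /=.
  by apply/fintype.subsetPn; exists u; rewrite !inE // ltxx.
have edet x y z w : (forall i, cmp (rk i (inl x)) (rk i (inr y)) =
    cmp (rk i (inl z)) (rk i (inr w))) -> e x y = e z w.
  move=> h; rewrite /e /sl_edge; congr phi; apply: boolp.funext => i /=.
  have lE x' y' : linval (A i) (B i) (C i) (p x') (p y') =
      f i (inl x') - f i (inr y') by rewrite /linval /f opprK.
  have := h i; rewrite /cmp !card_lt_homo !card_lt_eq => -[h1 h2].
  by rewrite !lE !(subr_lt0, subr_le0, subr_eq0) !le_eqVlt h1 h2.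
have noS' S : chain e S -> #|S| <> s by move=> cS Ss; apply: noS; exists S.
have [T cT [c cP]] := comparison_graph_coloring _ _ _ _ e
  (fun x i => rk i (inl x)) (fun x i => rk i (inr x))
  (fun x i => rkK i _) (fun x i => rkK i _) edet noS'.
have [k] : exists k, (n.-1 < #|[set x | c x == k]|)%N.
  apply: pigeonhole; rewrite card_ord cT; apply: leq_trans Nbig.
  by rewrite ltn_pmul2l ?prednK // muln_gt0 !expn_gt0 s0.
rewrite prednK // => /subset_of_card[S /fintype.subsetP SI cS]; exists S; split=> //.
move=> i j /SI + /SI; rewrite !inE => /eqP ci /eqP cj ij.
have [ji|ij'|/ord_inj eij] := ltngtP j i; last by rewrite eij eqxx in ij.
- by rewrite esym //; apply: cP => //; rewrite ci cj.
- by apply: cP => //; rewrite ci cj.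
Qed.

(** * Choice of the constants *)

(** Breaks a circularity: [K] will contain the term [d * t], while [4 * K.+1] must be absorbed by a
    factor [2 ^ d]. *)
Lemma exists_linear_le_exp2 (u t : nat) : exists d, (4 * (u + t * d) <= 2 ^ d)%N.
Proof.
have aux v : (5 <= v)%N -> (4 * (v + 2 * v * v) <= 2 ^ (2 * v))%N.
  elim: v => // v IH; rewrite leq_eqVlt => /orP[/eqP <- //|v5].
  have {IH} := IH v5; have -> : (2 ^ (2 * v.+1) = 4 * 2 ^ (2 * v))%N.
    by rewrite [(2 * v.+1)%N]mulnS expnD.
  by move: (2 ^ _)%N => m; nia.
exists (2 * (5 + u + t))%N; apply: leq_trans (aux _ _); nia.
Qed.

(** For [l = trunc_log 2 n], [2 ^ l <= n] bounds [l], and [l >= 1] gives [l.+1 <= 2 * l]. *)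
Lemma trunc_log2_le_ln (R : realType) (n : nat) : (2 <= n)%N ->
  (trunc_log 2 n).+1%:R <= 2 / ln 2 * ln n%:R :> R.
Proof.
move=> n2; set l := trunc_log 2 n.
have ln2 : 0 < ln 2 :> R by rewrite ln_gt0 // ltr1n.
have l1 : (1 <= l)%N by apply: trunc_log_max.
have ll : l%:R * ln 2 <= ln n%:R :> R.
  rewrite mulr_natl -lnXn ?ltr0n // -natrX.
  rewrite ler_ln ?posrE ?ltr0n ?expn_gt0 //; last by lia.
  by rewrite ler_nat; apply: trunc_logP => //; lia.
rewrite -mulrA [_^-1 * _]mulrC mulrA ler_pdivlMr //.
apply: (@le_trans _ _ (2 * (l%:R * ln 2))); last by rewrite ler_pM2l.
by rewrite mulrA ler_pM2r // -natrM ler_nat; lia.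
Qed.

(* R_t(s,n) <= X  is stated as: some N <= X has the Ramsey property
   (R_t(s,n) is the least such N). *)
Theorem theorem1p1 (R : realType) (t : nat) (ht : (0 < t)%N) :
  exists alpha beta gamma : R, 0 < alpha /\ 0 < beta /\ 0 < gamma /\
    forall s n : nat, (0 < s)%N -> (2 <= n)%N ->
      exists N : nat,
        (N%:R <= alpha * (s%:R `^ beta) * n%:R * ((ln (n%:R : R)) `^ gamma))
        /\ ramsey_prop R t s n N.
Proof.
pose Q := (4 ^ t)%N; have [d hd] := exists_linear_le_exp2 (3 + Q + 2 * t) t.
have ln2 : 0 < ln 2 :> R by rewrite ln_gt0 // ltr1n.
(* The [Q] in the exponent of [s] comes from the Mirsky colours; its extra [t] and the exponent of
   the logarithm come from [4 * K.+1 <= s * L * 2 ^ d] raised to the power [t]. *)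
exists ((2 ^ d)%:R ^+ t * (2 / ln 2) ^+ t), (Q + t)%:R, t%:R.
split; first by rewrite mulr_gt0 ?exprn_gt0 ?divr_gt0 ?ltr0n ?expn_gt0.
split; first by rewrite ltr0n addn_gt0 ht orbT.
split; first by rewrite ltr0n.
move=> s n s0 n2; pose L := (trunc_log 2 n).+1.
exists ((2 ^ d) ^ t * s ^ (Q + t) * n * L ^ t)%N; split.
  have lnn : 0 <= ln n%:R :> R by rewrite ln_ge0 // ler1n; lia.
  rewrite !powR_mulrn ?ler0n // !natrM !natrX.
  rewrite -!mulrA ler_pM2l ?exprn_gt0 ?ltr0n ?expn_gt0 //.
  rewrite [leRHS]mulrCA ler_pM2l ?exprn_gt0 ?ltr0n //.
  rewrite [leRHS]mulrCA ler_pM2l ?ltr0n //; last by lia.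
  rewrite -exprMn; apply: lerXn2r; rewrite ?nnegrE ?ler0n //.
    by rewrite mulr_ge0 // divr_ge0 // ltW.
  exact: trunc_log2_le_ln.
have nL : (n <= 2 ^ L)%N by apply/ltnW/trunc_log_ltn.
(* This is an exponent with [2 * N <= 2 ^ K], obtained from [n <= 2 ^ L] and the crude bounds
   [s <= 2 ^ s] and [L <= 2 ^ L]. *)
pose K := (1 + L + s * Q + d * t + t * s + t * L)%N.
apply: (@ramsey_prop_of_coloring _ _ _ _ _ K) => //.
- have le2 x : (x <= 2 ^ x)%N by apply/ltnW/ltn_expl.
  have le2X x m : (x ^ m <= 2 ^ (x * m))%N.
    by rewrite expnM; case: m => [|m]; rewrite ?expn0 // leq_exp2r ?le2.
  have -> : (2 ^ K =
      2 * (2 ^ (d * t) * (2 ^ (s * (Q + t)) * (2 ^ L * 2 ^ (L * t)))))%N.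
    by rewrite -[X in (X * _)%N]expn1 -!expnD /K; congr expn; ring.
  by rewrite -expnM -!mulnA !leq_mul.
- by lia.
(* With [m = s * L], bounding [1], [s] and [L] by [m] in each summand gives
   [K.+1 <= m * (3 + Q + 2 * t + t * d)], the form that [hd] handles. *)
have KL : (4 * K.+1 <= s * L * 2 ^ d)%N.
  have sL : (0 < s * L)%N by rewrite muln_gt0 s0.
  apply: leq_trans (leq_mul (leqnn (s * L)) hd).
  rewrite mulnCA leq_mul2l /= /K.
  have Lm : (L <= s * L)%N by rewrite leq_pmull.
  have sm : (s <= s * L)%N by rewrite leq_pmulr.
  move: (s * L)%N Lm sm sL => m Lm sm m0.
  have h1 := leq_mul sm (leqnn Q); have h2 := leq_mul m0 (leqnn (d * t)).
  have h3 := leq_mul (leqnn t) sm; have h4 := leq_mul (leqnn t) Lm.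
  nia.
apply: leq_trans (_ : (s * L * 2 ^ d) ^ t * s ^ Q * n <= _)%N.
  by rewrite !leq_mul2r leq_exp2r ?KL ?orbT.
by rewrite !expnMn expnD; apply/eq_leq; ring.
Qed.
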